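(* For each partition $\alpha$ of $n$ all of whose parts are odd, let $\alpha_1\ge\dots\ge\alpha_s\ge 3$ be its parts different from $1$ and set $C_n^\alpha=\sum \tau_{i^{(1)}_1\dots i^{(1)}_{\alpha_1}}\tau_{i^{(2)}_1\dots i^{(2)}_{\alpha_2}}\cdots\tau_{i^{(s)}_1\dots i^{(s)}_{\alpha_s}}$, the sum over all families of pairwise distinct indices $i^{(r)}_j\in\{1,\dots,n\}$ (with $C_n^\alpha=1$ if $s=0$). Then the elements $C_n^\alpha$, $\alpha$ ranging over the partitions of $n$ into odd parts, form a basis of the supercenter $SZ(\mathfrak A_n)$.
   Context: $\mathfrak A_n$ is the $\mathbb C$-algebra generated by $\tau_1,\dots,\tau_{n-1}$ with relations $\tau_k^2=1$, $(\tau_k\tau_{k+1})^3=1$, $(\tau_k\tau_l)^2=-1$ for $|k-l|>1$; it is $\mathbb Z_2$-graded with all $\tau_k$ odd (it is the quotient of the group algebra of Schur's double cover of $S_n$ by the relation central element $=-1$). Define $\tau_{i,i+1}=\tau_i$, $\tau_{ij}=-\tau_{i,j-1}\tau_{j-1}\tau_{i,j-1}$ for $i<j-1$, and $\tau_{ji}=-\tau_{ij}$; all $\tau_{ij}$ are odd. For pairwise distinct $i_1,\dots,i_p$, $\tau_{i_1i_2\dots i_p}=\tau_{i_1i_2}\tau_{i_2i_3}\cdots\tau_{i_{p-1}i_p}$. The supercenter $SZ(A)$ of a graded algebra is the span of homogeneous $a$ with $ab=(-1)^{p(a)p(b)}ba$ for all homogeneous $b\in A$. *)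

(* Defs.v *)
From HB Require Import structures.
From mathcomp Require Import all_boot all_order all_algebra all_field.
Set Implicit Arguments. Unset Strict Implicit. Unset Printing Implicit Defensive.
Import Order.TTheory GRing.Theory Num.Theory.
Local Open Scope ring_scope.

Section SergeevDefs.
Variable R : numClosedFieldType.
Variable n : nat.

(* The defining relations of A_n on a family tau : 'I_n.-1 -> A,
   where tau k (0-based k) stands for the paper's tau_{k+1}, k+1 in 1..n-1. *)
Definition An_rels (A : algType R) (tau : 'I_n.-1 -> A) : Prop :=
  [/\ forall k, tau k * tau k = 1,
      forall k l : 'I_n.-1, (l : nat) = k.+1 -> (tau k * tau l) ^+ 3 = 1 &
      forall k l : 'I_n.-1, ((k.+1 < l) || (l.+1 < k))%N ->
        (tau k * tau l) ^+ 2 = -1 ].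

(* (A, tau) is the algebra generated by the tau_k subject to these relations:
   the universal (initial) such algebra. *)
Definition An_universal (A : algType R) (tau : 'I_n.-1 -> A) : Prop :=
  forall (B : algType R) (tau' : 'I_n.-1 -> B), An_rels tau' ->
    (exists f : {lrmorphism A -> B}, forall k, f (tau k) = tau' k) /\
    (forall f g : {lrmorphism A -> B},
        (forall k, f (tau k) = tau' k) -> (forall k, g (tau k) = tau' k) ->
        f =1 g).

Variable A : algType R.
Variable tau : 'I_n.-1 -> A.

(* Z_2-grading with all tau_k odd: the even (resp. odd) part is the span of
   words in the tau_k of even (resp. odd) length. *)
Definition word_span (par : bool) (x : A) : Prop :=
  exists s : seq (R * seq 'I_n.-1),
    (forall p, p \in s -> odd (size p.2) = par) /\
    x = \sum_(p <- s) p.1 *: \prod_(k <- p.2) tau k.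

Definition homog (par : bool) (x : A) : Prop := word_span par x.

Definition homog_supercentral (x : A) : Prop :=
  exists pa : bool, homog pa x /\
    forall (pb : bool) (y : A), homog pb y ->
      x * y = (-1) ^+ (pa && pb) * (y * x).

Definition supercenter (x : A) : Prop :=
  exists s : seq A, (forall a, a \in s -> homog_supercentral a) /\
    x = \sum_(a <- s) a.

(* generator tau_k with the paper's 1-based index k (0 outside 1..n-1) *)
Definition gen (k : nat) : A :=
  if k is k'.+1 then (if insub k' is Some i then tau i else 0) else 0.

Fixpoint tau_lt (i j : nat) : A :=
  match j with
  | 0 => 0
  | j'.+1 =>
      if j' == i then gen i
      else if (i < j')%N then - (tau_lt i j' * gen j' * tau_lt i j')
      else 0
  end.

Definition tau2 (i j : nat) : A :=
  if (i < j)%N then tau_lt i j else if (j < i)%N then - tau_lt j i else 0.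

Definition tau_cycle (s : seq nat) : A :=
  if s is x :: s' then \prod_(t <- pairmap tau2 x s') t else 1.

End SergeevDefs.

Definition odd_partition (n : nat) (a : seq nat) : bool :=
  [&& sorted geq a, all odd a & sumn a == n].

(* C_n^alpha: sum over all families of pairwise distinct indices in {1..n}
   (encoded by injective tuples over 'I_n, shifted by 1) of the product
   tau_{cycle 1} ... tau_{cycle s} over the parts alpha_1 >= ... >= alpha_s
   of alpha different from 1. *)
Definition C_alpha (R : numClosedFieldType) (n : nat) (A : algType R)
    (tau : 'I_n.-1 -> A) (alpha : seq nat) : A :=
  let parts := [seq k <- alpha | k != 1%N] in
  \sum_(t : (sumn parts).-tuple 'I_n | uniq t)
     \prod_(b <- reshape parts [seq (nat_of_ord i).+1 | i <- (t : seq 'I_n)]) tau_cycle tau b.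

(* Main.v *)
Require Import Defs.
From HB Require Import structures.
From mathcomp Require Import all_boot all_order all_fingroup all_algebra all_field.
From mathcomp Require Import zify.
Import Order.TTheory GRing.Theory Num.Theory.
Set Implicit Arguments. Unset Strict Implicit. Unset Printing Implicit Defensive.
Local Open Scope ring_scope.

(** Conjugation by [tau_k] sends [tau_ij] to [- tau_(s_k i)(s_k j)]; hence a word in
    the [tau_k] is determined up to sign by its permutation, and a word [x] over
    [s] acts on [tau_ij] by [(-1)^s] and relabelling of the indices.

    Averaging a supercentral [x] over [S_n] multiplies it by [n!], and sends a word
    over [g] to [0] if [g] is odd (twist by the word itself) or has a cycle of even
    length (twist by that cycle), and to a multiple of [C_alpha] otherwise.

    For the independence, [tau_k |-> tau_k (x) s_k] extends to a morphism
    [A -> A[S_n]], i.e., [A] is graded by [S_n]; since an [algType] is nontrivial, no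
    concrete model of [A] is needed.  The component of [C_alpha] at [g] is a sum of
    words over [g] which are all equal: conjugate words differ by a sign, and an odd
    power of each of them is [1] or [-1]. *)

(** * Transpositions and signed words *)

Section Transpositions.
Variables (R : numClosedFieldType) (n : nat) (A : algType R) (tau : 'I_n.-1 -> A).
Hypothesis rels : An_rels tau.

Notation g := (gen tau).
Notation T := (tau_lt tau).

Lemma gen_ord k : (0 < k < n)%N -> exists2 i : 'I_n.-1, g k = tau i & k = i.+1.
Proof.
case: k => // k /= kn.
have kn' : (k < n.-1)%N by rewrite ltn_predRL.
by exists (Ordinal kn') => //; rewrite insubT.
Qed.

Lemma genK k : (0 < k < n)%N -> g k * g k = 1.
Proof. by case: rels => sq _ _ /gen_ord [i -> _]. Qed.

Lemma gen_far k l : (0 < k < n)%N -> (0 < l < n)%N ->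
  ((k.+1 < l) || (l.+1 < k))%N -> g k * g l = - (g l * g k).
Proof.
move=> kn ln kl; have gK := genK kn; have glK := genK ln.
case: rels => _ _ far.
have [i Ei ki] := gen_ord kn; have [j Ej lj] := gen_ord ln.
have : (g k * g l) ^+ 2 = -1.
  by rewrite Ei Ej far //; move: kl; rewrite ki lj !ltnS.
rewrite expr2 => /(congr1 (fun x => g k * (x * g l)))/eqP.
rewrite !mulrA gK mul1r -[_ * _ * g l]mulrA glK mulr1 mulrN1 mulNr => /eqP E.
by rewrite E opprK.
Qed.

Lemma gen_braid k : (0 < k)%N -> (k.+1 < n)%N ->
  g k * g k.+1 * g k = g k.+1 * g k * g k.+1.
Proof.
move=> k0 kn; have kn' : (0 < k < n)%N by rewrite k0 ltnW.
have gK := genK kn'; have gSK : g k.+1 * g k.+1 = 1 by rewrite genK.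
have [i Ei ki] := gen_ord kn'; have [j Ej kj] := gen_ord (kn : (0 < k.+1 < n)%N).
case: rels => _ br _.
(* With a = [g k] and b = [g k.+1], multiplying (ab)^3 = 1 on the right by bab collapses the left
   side to aba. *)
have : (g k * g k.+1) ^+ 3 = 1 by rewrite Ei Ej br //; apply/eqP; rewrite -eqSS -kj -ki.
rewrite 2!exprS expr1 => /(congr1 (fun x => x * (g k.+1 * g k * g k.+1))).
rewrite mul1r => <-; rewrite !mulrA.
rewrite -[in RHS](mulrA _ (g k.+1) (g k.+1)) gSK mulr1.
rewrite -[in RHS](mulrA _ (g k) (g k)) gK mulr1.
by rewrite -[in RHS](mulrA _ (g k.+1) (g k.+1)) gSK mulr1.
Qed.

Lemma tau_ltS i : T i i.+1 = g i.
Proof. by rewrite /= eqxx. Qed.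

Lemma tau_lt_rec i j : (i < j)%N -> T i j.+1 = - (T i j * g j * T i j).
Proof. by move=> ij; rewrite /= gtn_eqF // ij. Qed.

Lemma tau_lt_ind (P : nat -> nat -> Prop) i :
  P i i.+1 -> (forall j, (i < j)%N -> P i j -> P i j.+1) ->
  forall j, (i < j)%N -> P i j.
Proof.
move=> P0 PS; elim=> // j IH; rewrite ltnS leq_eqVlt => /predU1P[<- //|ij].
by apply: PS => //; apply: IH.
Qed.

Lemma tau_ltK i j : (0 < i < j)%N -> (j <= n)%N -> T i j * T i j = 1.
Proof.
case/andP=> i0; move: j.
apply: (@tau_lt_ind (fun i j => (j <= n)%N -> T i j * T i j = 1)) => [|j ij IH jn].
  by move=> ?; rewrite tau_ltS genK // i0.
have TK := IH (ltnW jn); have gK : g j * g j = 1 by rewrite genK // jn (leq_trans _ ij).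
rewrite tau_lt_rec // mulrNN !mulrA -[_ * T i j * T i j]mulrA TK mulr1.
by rewrite -[_ * g j * g j]mulrA gK mulr1.
Qed.

Lemma tau_lt_far i j k : (0 < i < j)%N -> (j < k < n)%N ->
  T i j * g k = - (g k * T i j).
Proof.
case/andP=> i0; move: j.
apply: (@tau_lt_ind (fun i j => (j < k < n)%N -> T i j * g k = - (g k * T i j))).
  case/andP=> ik kn; rewrite tau_ltS gen_far ?ik ?kn ?andbT //.
    by rewrite (ltn_trans _ kn) ?andbT // ltnW.
  by rewrite ltnW // (leq_ltn_trans _ ik).
move=> j ij IH /andP[jk kn]; have IHj := IH.
have {}IH : T i j * g k = - (g k * T i j) by apply: IH; rewrite ltnW.
have F : g j * g k = - (g k * g j).
  have k0 : (0 < k)%N by rewrite (leq_ltn_trans _ jk).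
  rewrite gen_far ?kn ?jk ?k0 //.
  by rewrite (ltn_trans (ltnW jk) kn) andbT (leq_trans _ ij).
rewrite tau_lt_rec // mulNr -[_ * T i j * g k]mulrA IH mulrN mulrA -[_ * g j * g k]mulrA F.
by rewrite mulrN mulNr !opprK !mulrA IH !mulNr mulrN !opprK !mulrA.
Qed.

(** Induction on [j], with a = [T i j], b = [g j], c = [g j.+1]. Then [T i j.+1] is -bab, and aba =
    bab, bcb = cbc, ac = -ca suffice to bring bab·c·bab to -c·bab·c. *)
Lemma tau_lt_braid i j : (0 < i < j)%N -> (j < n)%N ->
  T i j * g j * T i j = g j * T i j * g j.
Proof.
case/andP=> i0; move: j.
apply: (@tau_lt_ind (fun i j => (j < n)%N -> T i j * g j * T i j = g j * T i j * g j)).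
  by move=> ?; rewrite tau_ltS gen_braid.
move=> j ij IH jn; have {}IH := IH (ltnW jn).
have j0 : (0 < j)%N by rewrite (leq_ltn_trans _ ij).
have F : T i j * g j.+1 = - (g j.+1 * T i j) by rewrite tau_lt_far ?i0 // ltnSn.
have B := gen_braid j0 jn.
rewrite tau_lt_rec // IH; set a := T i j in F IH *; set b := g j in B IH *.
set c := g j.+1 in F B *.
rewrite !mulNr !mulrN !mulNr opprK.
have -> : b * a * b * c * (b * a * b) = b * a * (b * c * b) * a * b by rewrite !mulrA.
rewrite B.
have -> : b * a * (c * b * c) * a * b = b * (a * c) * b * (c * a) * b by rewrite !mulrA.
have F' : c * a = - (a * c) by rewrite F opprK.
have E : b * (a * c) = - (b * (c * a)) by rewrite F mulrN.
have -> : b * (a * c) * b * (c * a) * b = b * (c * a) * b * (a * c) * b.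
  by rewrite [in LHS]F' E !(mulrN, mulNr) opprK.
have -> : b * (c * a) * b * (a * c) * b = b * c * (a * b * a) * (c * b) by rewrite !mulrA.
rewrite IH.
have -> : b * c * (b * a * b) * (c * b) = (b * c * b) * a * (b * c * b) by rewrite !mulrA.
rewrite B.
have -> : c * b * c * a * (c * b * c) = c * b * (c * a) * c * b * c by rewrite !mulrA.
rewrite F' mulrN !mulNr; congr (- _).
have -> : c * b * (a * c) * c * b * c = c * b * a * (c * c) * b * c by rewrite !mulrA.
by rewrite genK // mulr1 !mulrA.
Qed.

(** By the braid relation the recursion is also a conjugation by a generator, which is the form that
    suits an induction on [j]. *)
Lemma tau_lt_recC i j : (0 < i < j)%N -> (j < n)%N -> T i j.+1 = - (g j * T i j * g j).
Proof. by move=> ij jn; rewrite -tau_lt_braid // tau_lt_rec //; case/andP: ij. Qed.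

Lemma tau2_lt i j : (i < j)%N -> tau2 tau i j = T i j.
Proof. by rewrite /tau2 => ->. Qed.

Lemma tau2N i j : tau2 tau j i = - tau2 tau i j.
Proof. by rewrite /tau2; case: ltngtP => // _; rewrite ?opprK ?oppr0. Qed.

Definition swapn k i := if i == k then k.+1 else if i == k.+1 then k else i.

Lemma swapnL k : swapn k k = k.+1.
Proof. by rewrite /swapn eqxx. Qed.

Lemma swapnR k : swapn k k.+1 = k.
Proof. by rewrite /swapn eqxx gtn_eqF. Qed.

Lemma swapnD k i : i != k -> i != k.+1 -> swapn k i = i.
Proof. by rewrite /swapn => /negPf-> /negPf->. Qed.

(** Induction on [j], writing [T i j.+1] as minus the conjugate of [T i j] by [g j] and locating [k]
    relative to [i] and [j]. *)
Lemma conj_tau_lt i j k : (0 < i < j)%N -> (j <= n)%N -> (0 < k < n)%N ->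
  g k * T i j * g k = - tau2 tau (swapn k i) (swapn k j).
Proof.
case/andP=> i0; move: j k.
pose P i j := forall k, (j <= n)%N -> (0 < k < n)%N ->
  g k * T i j * g k = - tau2 tau (swapn k i) (swapn k j).
suff H : forall j, (i < j)%N -> P i j by move=> j k ij; apply: H.
apply: tau_lt_ind => [|j ij IH] k jn kn; have gK := genK kn.
  have [kE|ki] := eqVneq k i.
    by subst k; rewrite swapnL swapnR -tau2N tau2_lt // tau_ltS genK ?mul1r //; lia.
  have [kE|kSi] := eqVneq k i.+1.
    subst k; rewrite swapnL swapnD ?tau2_lt ?(@tau_lt_recC i i.+1) ?opprK //; lia.
  have [iE|Ski] := eqVneq i k.+1.
    subst i; rewrite swapnR swapnD ?tau2_lt ?(@tau_lt_rec k k.+1) ?tau_ltS ?opprK //; lia.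
  rewrite !swapnD ?tau2_lt // ?tau_ltS //; try lia.
  by rewrite gen_far ?mulNr -?mulrA ?gK ?mulr1 //; lia.
have gjK : g j * g j = 1 by apply: genK; lia.
rewrite tau_lt_recC //; [|lia..].
have [kE|kj] := eqVneq k j.
  subst k; rewrite swapnR swapnD ?tau2_lt //; try lia.
  by rewrite mulrN mulNr !mulrA gjK mul1r -mulrA gjK mulr1.
have [kE|kSj] := eqVneq k j.+1.
  subst k; rewrite -tau_lt_recC //; [|lia..].
  by rewrite swapnL swapnD ?tau2_lt ?(@tau_lt_recC i j.+1) ?opprK //; lia.
(* Unless [j = k.+1], [g k] anticommutes with [g j], and the induction hypothesis applies inside the
   conjugation by [g j]. *)
have [jE|Skj] := eqVneq j k.+1; last first.
  have F : g k * g j = - (g j * g k) by apply: gen_far => //; lia.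
  have F' : g j * g k = - (g k * g j) by rewrite F opprK.
  have -> : g k * - (g j * T i j * g j) * g k = - (g j * (g k * T i j * g k) * g j).
    by rewrite mulrN mulNr !mulrA F !mulNr opprK -!mulrA F' !mulrN !mulrA.
  have sj : swapn k j = j by rewrite swapnD //; lia.
  have sj1 : swapn k j.+1 = j.+1 by rewrite swapnD //; lia.
  have si : (0 < swapn k i < j)%N by rewrite /swapn; do !case: eqP => ?; lia.
  rewrite IH //; last lia.
  rewrite sj sj1 !tau2_lt; [|lia..].
  by rewrite tau_lt_recC // mulrN mulNr.
have sj1 : swapn k j.+1 = j.+1 by rewrite swapnD //; lia.
have [kE|ki] := eqVneq k i.
  subst k j; rewrite swapnL sj1 tau_ltS tau2_lt // tau_ltS.
  rewrite -gen_braid //.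
  by rewrite mulrN mulNr !mulrA gK mul1r -mulrA gK mulr1.
(* Now [T i j.+1] is x = [T i k] conjugated by a = [g k], then by b = [g j]. Conjugating once more
   by a produces aba = bab on both sides of x, and b anticommutes with x. *)
have ik : (i < k)%N by lia.
have si : swapn k i = i by rewrite swapnD //; lia.
rewrite si sj1 tau2_lt; last lia.
rewrite (@tau_lt_recC i j) //; last lia.
subst j; rewrite (@tau_lt_recC i k); [|lia..].
rewrite !(mulrN, mulNr) !opprK.
have Bk : g k * g k.+1 * g k = g k.+1 * g k * g k.+1 by apply: gen_braid; lia.
set a := g k in gK Bk *; set b := g k.+1 in Bk gjK *; set x := T i k.
have -> : a * (b * (a * x * a) * b) * a = a * b * a * x * (a * b * a) by rewrite !mulrA.
rewrite Bk.
have -> : b * a * b * x * (b * a * b) = b * a * (b * x) * b * a * b by rewrite !mulrA.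
have F : x * b = - (b * x) by rewrite tau_lt_far //; lia.
have -> : b * x = - (x * b) by rewrite F opprK.
rewrite !(mulrN, mulNr); congr (- _).
have -> : b * a * (x * b) * b * a * b = b * a * x * (b * b) * a * b by rewrite !mulrA.
by rewrite gjK mulr1 !mulrA.
Qed.

(** * The action on ordinal indices, and words lying over permutations *)

Lemma adjacent_proof (k : 'I_n.-1) : (k.+1 < n)%N.
Proof. by rewrite -ltn_predRL. Qed.

Definition adj (k : 'I_n.-1) : 'S_n :=
  tperm (widen_ord (leq_pred n) k) (Ordinal (adjacent_proof k)).

Definition t2 (i j : 'I_n) : A := tau2 tau i.+1 j.+1.

Lemma gen_tau (k : 'I_n.-1) : g k.+1 = tau k.
Proof. by rewrite /= valK. Qed.

Lemma adjE k i : (adj k i).+1 = swapn k.+1 i.+1.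
Proof.
rewrite /adj /swapn; case: tpermP => [->|->|] /=; rewrite ?eqxx //.
  by rewrite gtn_eqF.
by move=> /eqP; rewrite -val_eqE eqSS => /negPf-> /eqP; rewrite -val_eqE eqSS => /negPf->.
Qed.

Lemma t2N i j : t2 j i = - t2 i j.
Proof. exact: tau2N. Qed.

Lemma t2_tau (k : 'I_n.-1) (i j : 'I_n) : i = k :> nat -> j = k.+1 :> nat -> t2 i j = tau k.
Proof. by rewrite /t2 => -> ->; rewrite tau2_lt // tau_ltS gen_tau. Qed.

Lemma t2K i j : i != j -> t2 i j * t2 i j = 1.
Proof.
wlog ij : i j / (i < j)%N.
  move=> W; rewrite -val_eqE neq_ltn => /orP[ij|ji]; first by apply: W; rewrite // -val_eqE ltn_eqF.
  by rewrite t2N mulrNN W // -val_eqE ltn_eqF.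
by move=> _; rewrite /t2 tau2_lt // tau_ltK //.
Qed.

Lemma t2_conj k i j : i != j -> t2 i j * tau k = - (tau k * t2 (adj k i) (adj k j)).
Proof.
wlog ij : i j / (i < j)%N.
  move=> W; rewrite -val_eqE neq_ltn => /orP[ij|ji]; first by apply: W; rewrite // -val_eqE ltn_eqF.
  by rewrite t2N mulNr W -?val_eqE ?ltn_eqF // [t2 (adj k i) _]t2N mulrN.
move=> _; have kn : (0 < k.+1 < n)%N by rewrite /= adjacent_proof.
have := @conj_tau_lt i.+1 j.+1 k.+1 ij (ltn_ord j) kn.
rewrite -!adjE gen_tau /t2 [tau2 _ i.+1 _]tau2_lt // => E.
rewrite -mulrN -E -!gen_tau !mulrA genK // mul1r //.
Qed.

(** A relation rather than a function on elements, as an element is not yet known to determine its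
    permutation. The bound [m] on the letters also bounds the moved indices and drives the induction
    of [mono1_sign_lt]; [m = n] allows every letter. *)
Inductive mono (m : nat) : A -> 'S_n -> Prop :=
| Mono1 : mono m 1 1%g
| MonoM x s (k : 'I_n.-1) : (k.+1 < m)%N -> mono m x s -> mono m (x * tau k) (s * adj k)%g
| MonoN x s : mono m x s -> mono m (- x) s.

Lemma mono_mul m x y s t : mono m x s -> mono m y t -> mono m (x * y) (s * t)%g.
Proof.
move=> mx; elim=> [|{}y {}t k km _ IH|{}y {}t _ IH].
- by rewrite mulr1 mulg1.
- by rewrite mulrA mulgA; apply: MonoM.
- by rewrite mulrN; apply: MonoN.
Qed.

Lemma mono_tau m (k : 'I_n.-1) : (k.+1 < m)%N -> mono m (tau k) (adj k).
Proof. by move=> km; rewrite -[tau k]mul1r -[adj k]mul1g; do 2?constructor. Qed.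

Lemma odd_adj k : odd_perm (adj k).
Proof. by rewrite odd_tperm -val_eqE /= neq_ltn ltnSn. Qed.

Lemma t2_mono m x s i j : mono m x s -> i != j ->
  t2 i j * x = (-1) ^+ odd_perm s * (x * t2 (s i) (s j)).
Proof.
move=> mx; elim: mx i j => [|{}x {}s k _ _ IH|{}x {}s _ IH] i j ij.
- by rewrite odd_perm1 !perm1 mulr1 !mul1r.
- rewrite mulrA IH // odd_permM odd_adj signr_addb -!mulrA t2_conj ?(inj_eq perm_inj) //.
  by rewrite !permM !mulrN mulN1r mulrN.
- by rewrite mulrN IH // mulNr mulrN.
Qed.

(** Descent on the larger index: [t2 i j] is minus the conjugate of [t2 i (j-1)] by the generator
    exchanging [j-1] and [j], so no letter exceeds the bound. *)
Lemma mono_t2 m (i j : 'I_n) : (i < m)%N -> (j < m)%N -> i != j -> mono m (t2 i j) (tperm i j).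
Proof.
wlog ij : i j / (i < j)%N.
  move=> W im jm; rewrite -val_eqE neq_ltn => /orP[ij|ji].
    by apply: W; rewrite // -val_eqE ltn_eqF.
  by rewrite t2N tpermC; apply/MonoN/W; rewrite // -val_eqE ltn_eqF.
move=> _ jm _; have [l jl] := ubnP (j : nat); elim: l => // l IH in i j ij jm jl *.
have jn := ltn_ord j.
have kn : (j.-1 < n.-1)%N by lia.
pose k := Ordinal kn.
have jk : j = k.+1 :> nat by rewrite /= prednK // (leq_ltn_trans _ ij).
have [ik|ik] := eqVneq (i : nat) k.
  rewrite (t2_tau ik jk); have -> : tperm i j = adj k by rewrite /adj; congr tperm; apply: val_inj.
  by apply: mono_tau; rewrite -jk.
have j'n : (j.-1 < n)%N by lia.
pose j' := Ordinal j'n.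
have mk : mono m (tau k) (adj k) by apply: mono_tau; rewrite -jk.
have mi : mono m (t2 i j') (tperm i j').
  apply: IH; rewrite /=; lia.
have sj : adj k j' = j.
  by rewrite /adj -[RHS](tpermL j' j); congr (tperm _ _ _); apply: val_inj.
have si : adj k i = i.
  by rewrite /adj tpermD // -val_eqE /=; move: ij ik; rewrite /=; lia.
have E : t2 i j' * tau k = - (tau k * t2 i j).
  by rewrite t2_conj ?si ?sj // -val_eqE.
have tK : tau k * tau k = 1 by rewrite -gen_tau genK // -jk jn andbT jk.
have -> : t2 i j = - (tau k * t2 i j' * tau k) by rewrite -mulrA E mulrN opprK mulrA tK mul1r.
have -> : tperm i j = (adj k * tperm i j' * adj k)%g.
  by rewrite -{1}[adj k]tpermV -/(adj k) -mulgA -conjgE tpermJ si sj.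
by apply/MonoN/mono_mul => //; apply: mono_mul.
Qed.

Lemma mono_fix m x s (i : 'I_n) : mono m x s -> (m <= i)%N -> s i = i.
Proof.
move=> mx mi; elim: mx => [|{}x {}s k km _ IH|//]; first by rewrite perm1.
by rewrite permM IH /adj tpermD // -val_eqE /=; lia.
Qed.

(* Coset decomposition of the words in tau_1, .., tau_m with respect to the
   words in tau_1, .., tau_(m-1): the representatives are 1 and the t2 i m. *)
Lemma mono_coset (m : 'I_n) x s : mono m.+1 x s ->
  exists y t, mono m y t /\
    ((x = y /\ s = t) \/
     exists2 i : 'I_n, (i < m)%N & x = y * t2 i m /\ s = (t * tperm i m)%g).
Proof.
elim=> [|{}x {}s k km _ [y [t [my [[-> ->]|[i im [-> ->]]]]]]
         |{}x {}s _ [y [t [my [[-> ->]|[i im [-> ->]]]]]]].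
- by exists 1, 1%g; split; [constructor|left].
- move: km; rewrite ltnS leq_eqVlt => /orP[/eqP kE|km]; last first.
    by exists (y * tau k), (t * adj k)%g; split; [exact: MonoM|left].
  exists y, t; split=> //; right; exists (widen_ord (leq_pred n) k); first by rewrite /= -kE.
  rewrite (t2_tau (k := k)) //; split=> //; congr (_ * tperm _ _)%g.
  by apply: val_inj => /=.
- have mi : m != i by rewrite -val_eqE gtn_eqF.
  (* The last letter is [t2 k' m] with [k' = m-1]. It cancels the representative if [i = k'];
     otherwise [t2 i m * t2 k' m] equals [- t2 k' i * t2 i m], and the representative is kept. *)
  move: km; rewrite ltnS leq_eqVlt => /orP[/eqP kE|km].
    pose k' := widen_ord (leq_pred n) k.
    have km : m = Ordinal (adjacent_proof k) by apply: val_inj.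
    have kk : tau k = t2 k' m by rewrite (@t2_tau k).
    have ak : adj k = tperm k' m by rewrite /adj km.
    have k'm : (k' < m)%N by rewrite -kE.
    have [ik|ik] := eqVneq i k'.
      exists y, t; split=> //; left.
      by rewrite ik kk ak -mulrA -mulgA tperm2 t2K ?mulr1 ?mulg1 // -ik eq_sym.
    exists (y * - t2 k' i), (t * tperm k' i)%g; split.
      by apply: mono_mul => //; rewrite -t2N tpermC; apply: mono_t2.
    right; exists i => //; rewrite -!mulrA -!mulgA; split.
      congr (_ * _); rewrite mulNr [in RHS](@t2_mono m.+1 _ (tperm i m)) ?(eq_sym k') //.
        rewrite odd_tperm eq_sym mi expr1 mulN1r opprK tpermL tpermD ?kk //.
        by rewrite eq_sym -val_eqE ltn_eqF.
      by apply: mono_t2; rewrite // ?ltnS 1?ltnW // eq_sym.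
    congr (_ * _)%g; have <- : (tperm k' m ^ tperm i m)%g = tperm k' i.
      by rewrite tpermJ tpermR tpermD // eq_sym -val_eqE ltn_eqF.
    by rewrite ak conjgE tpermV -!mulgA tperm2 mulg1.
  (* A smaller letter fixes [m], so it passes to the left of the representative and changes [i] into
     [adj k i]. *)
  have aim : adj k m = m by rewrite /adj tpermD // -val_eqE /=; lia.
  exists (y * - tau k), (t * adj k)%g; split.
    by rewrite mulrN; apply/MonoN/MonoM.
  right; exists (adj k i).
    by rewrite /adj; case: tpermP => //= _; exact: ltnW.
  split.
    by rewrite -!mulrA t2_conj ?aim 1?eq_sym // mulNr.
  rewrite -[in RHS]aim -tpermJ conjgE -!mulgA; congr (_ * _)%g.
  by rewrite mulKVg.
- by exists (- y), t; split; [constructor|left].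
- by exists (- y), t; split; [constructor|right; exists i; rewrite ?mulNr].
Qed.

(** Induction along the coset decomposition: a nontrivial representative [t2 i m] would give a
    permutation sending [m] to [i], which is not the identity. *)
Lemma mono1_sign_lt m x : (m <= n)%N -> mono m x 1%g -> x = 1 \/ x = -1.
Proof.
elim: m x => [|m IH] x mn.
  (* For [m = 0] there are no letters, whatever the permutation. *)
  move: 1%g => s mx; elim: mx => [|//|{}x {}s _ [->|->]]; first by left.
    by right.
  by left; rewrite opprK.
case/(@mono_coset (Ordinal mn)) => y [t [my [[-> ts]|[i im [_ ts]]]]].
  by apply: IH; [exact: ltnW | rewrite ts].
have /(congr1 (fun s : 'S_n => s (Ordinal mn))) := ts.
rewrite permM perm1 (mono_fix my) // tpermR => mi.
by move: im; rewrite -mi ltnn.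
Qed.

End Transpositions.

(** * Cycle decompositions of permutations *)

Section CyclePerm.
Variable T : finType.
Implicit Types (b : seq T) (bs : seq (seq T)) (i : T).

(** The permutation under [tau_cycle]. As products act from left to right, each entry goes to its
    predecessor in [b], which is why orbits are taken below for the inverse. *)
Definition cperm b : {perm T} :=
  if b is x :: b' then (\prod_(s <- pairmap tperm x b') s)%g else 1%g.

Arguments cperm : simpl never.

Definition cycprod bs : {perm T} := (\prod_(b <- bs) cperm b)%g.

Lemma cperm1 x : cperm [:: x] = 1%g.
Proof. by rewrite /cperm big_nil. Qed.

Lemma cperm_cons x y b : cperm (x :: y :: b) = (tperm x y * cperm (y :: b))%g.
Proof. by rewrite /cperm big_cons. Qed.

Lemma seq_cons2_ind (P : seq T -> Prop) :
  P [::] -> (forall x, P [:: x]) ->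
  (forall x y b, P (y :: b) -> P (x :: y :: b)) -> forall b, P b.
Proof. by move=> P0 P1 PS; case=> // x b; elim: b x => // y b IH x; apply: PS. Qed.

Lemma cperm_out b i : i \notin b -> cperm b i = i.
Proof.
elim/seq_cons2_ind: b => [|x|x y b IH]; rewrite ?cperm1 ?perm1 //.
rewrite in_cons negb_or => /andP[ix iyb]; rewrite cperm_cons permM tpermD ?IH // eq_sym //.
by move: iyb; rewrite in_cons negb_or => /andP[].
Qed.

Lemma cperm_cycle b : uniq b -> path.cycle (fun i j => cperm b j == i) b.
Proof.
case: b => // x b U; rewrite /= rcons_path; move: U.
suff H : uniq (x :: b) -> path (fun i j => cperm (x :: b) j == i) x b /\
    cperm (x :: b) x = last x b by move=> /H[-> ->] /=.
elim: b x => [|y b IH] x; first by rewrite cperm1 perm1.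
rewrite [uniq _]/= => /andP[xyb Uy]; have [pb lb] := IH y Uy.
have [xy xb] : x != y /\ x \notin b by apply/andP; rewrite -negb_or.
have yb : y \notin b by case/andP: Uy.
rewrite cperm_cons permM tpermL lb; split=> //.
rewrite /= permM tpermR cperm_out // eqxx /=.
apply/(pathP x) => i ib; have jb := mem_nth x ib; have := pathP x pb i ib.
rewrite permM tpermD //.
  by apply: contraNneq xb => ->.
by apply: contraNneq yb => ->.
Qed.

Lemma odd_cperm b : uniq b -> b != [::] -> odd_perm (cperm b) = ~~ odd (size b).
Proof.
elim/seq_cons2_ind: b => [|x|x y b IH] //; first by rewrite cperm1 odd_perm1.
move=> /= /andP[xyb U] _; rewrite cperm_cons odd_permM IH // odd_tperm.
by move: xyb; rewrite in_cons negb_or => /andP[-> _] /=.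
Qed.

Lemma cycprod_cons b bs : cycprod (b :: bs) = (cperm b * cycprod bs)%g.
Proof. by rewrite /cycprod big_cons. Qed.

Lemma cycprod_out bs i : i \notin flatten bs -> cycprod bs i = i.
Proof.
elim: bs => [|b bs IH]; first by rewrite /cycprod big_nil perm1.
by rewrite /= mem_cat negb_or cycprod_cons permM => /andP[ib ibs]; rewrite cperm_out ?IH.
Qed.

Lemma cperm_mem b i : (cperm b i \in b) = (i \in b).
Proof.
apply/idP/idP; first by apply: contraLR => ib; rewrite cperm_out.
by apply: contraLR => ib; have /perm_inj <- := cperm_out ib.
Qed.

Lemma cycprod_in bs b i : uniq (flatten bs) -> b \in bs -> i \in b -> cycprod bs i = cperm b i.
Proof.
elim: bs => // c bs IH /=; rewrite cat_uniq => /and3P[_ /hasPn cbs U].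
rewrite cycprod_cons permM in_cons => /orP[/eqP-> ic|bbs ib].
  by rewrite cycprod_out //; apply/negP => /cbs /=; rewrite cperm_mem ic.
have ibs : i \in flatten bs by apply/flattenP; exists b.
by rewrite (cperm_out (cbs _ ibs)) IH.
Qed.

Lemma cycprod_perm_eq bs cs : uniq (flatten bs) -> perm_eq bs cs -> cycprod bs = cycprod cs.
Proof.
move=> U bc; have fbc : perm_eq (flatten bs) (flatten cs) by apply: perm_flatten.
have U' : uniq (flatten cs) by rewrite -(perm_uniq fbc).
apply/permP => i; have [/flattenP[b bb ib]|ib] := boolP (i \in flatten bs).
  by rewrite !(@cycprod_in _ b) // -(perm_mem bc).
by rewrite !cycprod_out // -(perm_mem fbc).
Qed.

Lemma order_cycprod bs b i : uniq (flatten bs) -> b \in bs -> i \in b ->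
  fingraph.order (cycprod bs)^-1%g i = size b.
Proof.
move=> U bb ib; have Ub : uniq b.
  elim: bs U bb => // c bs IH; rewrite /= cat_uniq => /and3P[Uc _ /IH{}IH].
  by rewrite in_cons => /predU1P[->|/IH].
apply: order_cycle ib => //; have := cperm_cycle Ub.
case: b bb Ub => // x b bb Ub /(pathP x) P; apply/(pathP x) => j jb; have := P j jb.
rewrite -(cycprod_in U bb) => [/eqP <-|]; first by rewrite /frel /= permK.
by have := mem_nth x jb; rewrite mem_rcons.
Qed.

(** Induction on the size of [D]. With [y] the preimage of [x], the permutation [tperm x y * g]
    fixes [x]. If [y] differs from [x], then [x] is put in front of the block starting at [y], hence
    the prescribed first element; otherwise [x] is a block by itself. *)
Lemma cperm_decomp_in (D : {set T}) x (g : {perm T}) : x \in D -> perm_on D g ->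
  exists s bs, perm_eq (flatten ((x :: s) :: bs)) (enum D) /\
    g = cycprod ((x :: s) :: bs).
Proof.
have [k] := ubnP #|D|; elim: k => // k IH in D x g *; rewrite ltnS => Dk xD gD.
have eD : perm_eq (enum D) (x :: enum (D :\ x)).
  apply: uniq_perm; rewrite /= ?enum_uniq ?mem_enum ?setD11 // => z.
  by rewrite in_cons !mem_enum in_setD1; case: eqP => // ->.
have Dx : (#|D :\ x| < k)%N by rewrite (cardsD1 x D) xD in Dk.
pose y := g^-1%g x; have gy : g y = x by rewrite permKV.
pose h := (tperm x y * g)%g.
have hD : perm_on (D :\ x) h.
  apply/subsetP => z; rewrite inE in_setD1; apply: contraR.
  rewrite negb_and negbK permM => /orP[/eqP->|zD]; first by rewrite tpermL gy.
  have yD : y \in D by rewrite -(perm_closed y gD) gy.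
  rewrite tpermD ?(out_perm gD) //.
    by apply: contraNneq zD => <-.
  by apply: contraNneq zD => <-.
have gE : g = (tperm x y * h)%g by rewrite mulgA tperm2 mul1g.
have [yx|yx] := eqVneq y x.
  have {gE} gE : g = h by rewrite gE yx tperm1 mul1g.
  rewrite gE; have [D0|[z zD]] := set_0Vmem (D :\ x).
    exists [::], [::]; split; last first.
      rewrite cycprod_cons cperm1 mul1g /cycprod big_nil.
      by apply/permP => z; rewrite perm1 (out_perm hD) // D0 inE.
    by rewrite perm_sym (perm_trans eD) // D0 enum_set0.
  have [s [bs [pE hE]]] := IH _ z h Dx zD hD.
  exists [::], ((z :: s) :: bs); split; last by rewrite cycprod_cons cperm1 mul1g.
  by rewrite perm_sym (perm_trans eD) //= perm_cons perm_sym.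
have yD : y \in D :\ x by rewrite in_setD1 yx -(perm_closed y gD) gy.
have [s [bs [pE hE]]] := IH _ y h Dx yD hD.
exists (y :: s), bs; split.
  by rewrite perm_sym (perm_trans eD) //= perm_cons perm_sym.
by rewrite gE hE !cycprod_cons cperm_cons mulgA.
Qed.

(* Every element of the domain occurs in [bs], so fixed points are cycles of length 1. *)
Lemma cperm_decomp (g : {perm T}) : exists bs,
  [/\ perm_eq (flatten bs) (enum T), [::] \notin bs, sorted geq (map size bs) & g = cycprod bs].
Proof.
have [bs0 [p0 n0 g0]] : exists bs,
    [/\ perm_eq (flatten bs) (enum T), [::] \notin bs & g = cycprod bs].
  have [T0|[x _]] := set_0Vmem [set: T].
    exists [::]; split=> //.
      by apply: uniq_perm; rewrite ?enum_uniq // => z; have := in_setT z; rewrite T0 inE.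
    by apply/permP => z; have := in_setT z; rewrite T0 inE.
  have [|s [bs [pE gE]]] := cperm_decomp_in (in_setT x) (g := g).
    by apply/subsetP => z _; rewrite inE.
  exists [seq b <- (x :: s) :: bs | b != [::]]; split.
  - apply: perm_trans (_ : perm_eq _ (enum [set: T])) _; last first.
      by apply: uniq_perm; rewrite ?enum_uniq // => z; rewrite !mem_enum in_setT.
    apply: perm_trans pE; apply/eqP/esym/eqP; move: (_ :: bs) => cs.
    by elim: cs => //= -[|y c] cs IH //=; rewrite perm_cons perm_cat2l.
  - by rewrite mem_filter eqxx.
  - rewrite gE; move: (_ :: bs) => cs; rewrite /cycprod big_filter.
    by rewrite [RHS]big_mkcond /= big_mkcond /=; apply: eq_bigr => -[].
(* Disjoint blocks may be reordered, here by decreasing length, so that the lengths form a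
   partition. *)
pose e (b c : seq T) := (size b >= size c)%N.
have pS : perm_eq bs0 (sort e bs0) by rewrite perm_sym perm_sort.
have U : uniq (flatten bs0) by rewrite (perm_uniq p0) enum_uniq.
exists (sort e bs0); split.
- by rewrite -(permPr p0); apply: perm_flatten; rewrite perm_sym.
- by rewrite mem_sort.
- by rewrite sorted_map; apply: sort_sorted => b c; apply: leq_total.
- by rewrite g0; apply: cycprod_perm_eq.
Qed.

(* Hence [cycprod bs] determines the multiset of the lengths other than [1]. *)
Lemma cycprod_count bs k : uniq (flatten bs) -> k != 1%N ->
  (#|[set i | fingraph.order (cycprod bs)^-1%g i == k]| =
     k * count_mem k [seq size b | b <- bs])%N.
Proof.
move=> U k1.
have -> : #|[set i | fingraph.order (cycprod bs)^-1%g i == k]| =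
    count (fun i => fingraph.order (cycprod bs)^-1%g i == k) (flatten bs).
  rewrite -size_filter cardE; apply: perm_size; apply: uniq_perm.
  - exact: enum_uniq.
  - exact: filter_uniq.
  move=> i; rewrite mem_enum inE mem_filter; case: eqP => //= ik.
  (* A point outside all blocks is fixed, so its orbit has length 1, which differs from [k]. *)
  apply/esym; apply: contraTT isT => ibs; move: k1; rewrite -ik.
  have -> //: fingraph.order (cycprod bs)^-1%g i = 1%N.
  apply: (@order_cycle _ _ [:: i]); rewrite ?inE //= andbT.
  by rewrite -{1}(cycprod_out ibs) permK.
have H b i : b \in bs -> i \in b -> fingraph.order (cycprod bs)^-1%g i = size b.
  exact: order_cycprod.
move: H; move: (cycprod bs)^-1%g => h; elim: bs {U} => [|b bs IH] H //=; first by rewrite muln0.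
rewrite count_cat IH ?mulnDr => [|c i cb]; last by apply: H; rewrite in_cons cb orbT.
congr (_ + _)%N; have Hb i : i \in b -> fingraph.order h i = size b by apply: H; rewrite mem_head.
rewrite (eq_in_count (a2 := fun => size b == k)) => [|i /Hb -> //].
by case: eqP => [<-|_]; rewrite ?count_predT ?muln1 ?count_pred0 ?muln0.
Qed.

End CyclePerm.
Arguments cperm : simpl never.

(** * Products of cycles and supercentral averages *)

Section TupleOrbits.
Variable T : finType.

(** A permutation that is right on the tails is corrected at [x] by the transposition of [h x] and
    [y], neither of which is an image of the tail. *)
Lemma perm_uniq_trans (s t : seq T) : size s = size t -> uniq s -> uniq t ->
  exists h : {perm T}, map h s = t.
Proof.
elim: s t => [|x s IH] [|y t] //=; first by exists 1%g.
case=> st /andP[xs Us] /andP[yt Ut]; have [h ht] := IH t st Us Ut.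
exists (h * tperm (h x) y)%g; rewrite permM tpermL; congr (_ :: _).
rewrite -[RHS]ht; apply/eq_in_map => z zs; rewrite permM tpermD //.
  by rewrite (inj_eq perm_inj); apply: contraNneq xs => ->.
by apply: contraNneq yt => ->; rewrite -ht map_f.
Qed.

(** Orbit counting: [N] is the order of the stabiliser of [t], and by transitivity each fibre of
    [h |-> h t] is a coset of it. *)
Lemma sum_perm_tuple (V : zmodType) m (t : m.-tuple T) (F : m.-tuple T -> V) : uniq t ->
  exists N : nat, \sum_(h : {perm T}) F (map_tuple h t) = (\sum_(u : m.-tuple T | uniq u) F u) *+ N.
Proof.
move=> Ut; exists #|[pred h : {perm T} | map_tuple h t == t]|.
rewrite (partition_big (fun h : {perm T} => map_tuple h t) (fun u => uniq u)) /=; last first.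
  by move=> h _; rewrite map_inj_uniq //; apply: perm_inj.
rewrite -sumrMnl; apply: eq_bigr => u Uu.
have [|h0 hu] := perm_uniq_trans _ Ut Uu; first by rewrite !size_tuple.
rewrite (eq_bigr (fun=> F u)); last by move=> h /eqP->.
rewrite (reindex_inj (mulIg h0)) -sumr_const; apply: eq_bigl => h.
rewrite inE -val_eqE -[_ == t]val_eqE /= -hu.
rewrite (_ : map (h * h0)%g t = map h0 (map h t)); last first.
  by rewrite -map_comp; apply: eq_map => i; rewrite /= permM.
by apply: inj_eq; apply: inj_map; apply: perm_inj.
Qed.

End TupleOrbits.

(** * Words over permutations, products of cycles and their averages *)

Section SignedWords.
Variables (R : numClosedFieldType) (n : nat) (A : algType R) (tau : 'I_n.-1 -> A).
Hypothesis rels : An_rels tau.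

Notation mon := (mono tau n).
Notation t2 := (t2 tau).

Lemma algT_opp_neq (x : A) : x = - x -> x = 0.
Proof.
move/eqP; rewrite -addr_eq0 -[x]scale1r -scalerDl scaler_eq0 -(natrD _ 1 1) pnatr_eq0 /=.
by rewrite scale1r => /eqP.
Qed.

Lemma mono_gen k : mon (tau k) (adj k).
Proof. exact/mono_tau/adjacent_proof. Qed.

Lemma mono_word_prod (w : seq 'I_n.-1) : mon (\prod_(k <- w) tau k) (\prod_(k <- w) adj k)%g.
Proof.
elim: w => [|k w IH]; first by rewrite !big_nil; constructor.
by rewrite !big_cons; apply: mono_mul => //; apply: mono_gen.
Qed.

Lemma monoP x s : mon x s -> exists (w : seq 'I_n.-1) (e : bool),
  x = (-1) ^+ e * \prod_(k <- w) tau k /\ s = (\prod_(k <- w) adj k)%g.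
Proof.
elim=> [|{}x {}s k _ _ [w [e [-> ->]]]|{}x {}s _ [w [e [-> ->]]]].
- by exists [::], false; rewrite !big_nil mulr1.
- by exists (rcons w k), e; rewrite -cats1 !big_cat !big_seq1 mulrA.
- by exists w, (~~ e); rewrite signrN mulNr.
Qed.

Lemma odd_word (w : seq 'I_n.-1) : odd_perm (\prod_(k <- w) adj k)%g = odd (size w).
Proof.
by elim: w => [|k w IH]; rewrite ?big_nil ?odd_perm1 // big_cons odd_permM odd_adj IH.
Qed.

Lemma tauK k : tau k * tau k = 1.
Proof. by case: rels. Qed.

Lemma word_rev (w : seq 'I_n.-1) : \prod_(k <- w) tau k * \prod_(k <- rev w) tau k = 1.
Proof.
elim: w => [|k w IH]; first by rewrite !big_nil mulr1.
by rewrite rev_cons -cats1 big_cat big_seq1 big_cons -mulrA (mulrA _ _ (tau k)) IH mul1r tauK.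
Qed.

Lemma rev_word (w : seq 'I_n.-1) : \prod_(k <- rev w) tau k * \prod_(k <- w) tau k = 1.
Proof. by rewrite -{2}[w]revK word_rev. Qed.

Lemma mono1_sign x : mon x 1%g -> exists e : bool, x = (-1) ^+ e.
Proof. by case/(mono1_sign_lt rels (leqnn n)) => ->; [exists false|exists true]. Qed.

(** The reversed word inverts a word, so multiplying by it reduces the claim to words over the
    identity. *)
Lemma mono_sign_uniq x y s : mon x s -> mon y s -> exists e : bool, x = (-1) ^+ e * y.
Proof.
move=> mx /monoP[w [e [-> sE]]]; have mr := mono_word_prod (rev w).
have : mon (x * \prod_(k <- rev w) tau k) 1%g.
  have <- : (s * \prod_(k <- rev w) adj k)%g = 1%g; last exact: mono_mul.
  rewrite sE; elim: w {sE mr} => [|k w IH]; first by rewrite !big_nil mulg1.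
  rewrite rev_cons -cats1 big_cat big_seq1 big_cons -mulgA (mulgA _ _ (adj k)) IH mul1g.
  exact: tperm2.
case/mono1_sign => e' xE; exists (e' (+) e).
rewrite signr_addb -mulrA (mulrA (_ ^+ e) (_ ^+ e)) -expr2 sqrr_sign mul1r -xE.
by rewrite -mulrA rev_word mulr1.
Qed.

Lemma homog0 b : homog tau b 0.
Proof. by exists [::]; rewrite big_nil. Qed.

Lemma homogD b x y : homog tau b x -> homog tau b y -> homog tau b (x + y).
Proof.
move=> [s [sb ->]] [t [tb ->]]; exists (s ++ t); rewrite big_cat; split=> // p.
by rewrite mem_cat => /orP[/sb|/tb].
Qed.

Lemma mono_homog x s : mon x s -> homog tau (odd_perm s) x.
Proof.
case/monoP=> w [e [-> ->]]; exists [:: ((-1) ^+ e, w)]; rewrite big_seq1 odd_word; split.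
  by move=> p; rewrite inE => /eqP->.
by rewrite scaler_sign; case: e; rewrite ?mul1r // expr1 mulN1r.
Qed.

Lemma word_exists (h : 'S_n) : exists w : seq 'I_n.-1, (\prod_(k <- w) adj k)%g == h.
Proof.
suff [x /monoP[w [e [_ ->]]]] : exists x, mon x h by exists w.
have [ts -> /allP tsP] := prod_tpermP h; elim: ts tsP => [|t ts IH] tsP.
  by exists 1; rewrite big_nil; constructor.
have [|x mx] := IH; first by move=> u uts; apply: tsP; rewrite in_cons uts orbT.
exists (t2 t.1 t.2 * x); rewrite big_cons; apply: mono_mul => //.
by apply: (mono_t2 rels); rewrite ?ltn_ord //; apply: tsP; rewrite mem_head.
Qed.

(** A chosen section of the map from words to permutations; [lift] is multiplicative only up to
    sign, and [colift] is its inverse. *)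
Definition lift_word h := xchoose (word_exists h).
Definition lift h := \prod_(k <- lift_word h) tau k.
Definition colift h := \prod_(k <- rev (lift_word h)) tau k.

Lemma lift_mono h : mon (lift h) h.
Proof. by rewrite -{2}(eqP (xchooseP (word_exists h))); apply: mono_word_prod. Qed.

Lemma liftK h : lift h * colift h = 1.
Proof. exact: word_rev. Qed.

Lemma coliftK h : colift h * lift h = 1.
Proof. exact: rev_word. Qed.

Definition tcyc (b : seq 'I_n) : A := tau_cycle tau [seq (val i).+1 | i <- b].
Definition tprod (bs : seq (seq 'I_n)) : A := \prod_(b <- bs) tcyc b.

Lemma tcyc1 i : tcyc [:: i] = 1.
Proof. by rewrite /tcyc /tau_cycle /= big_nil. Qed.

Lemma tcyc_cons i j b : tcyc (i :: j :: b) = t2 i j * tcyc (j :: b).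
Proof. by rewrite /tcyc /tau_cycle /= big_cons. Qed.

Lemma tprod_cons b bs : tprod (b :: bs) = tcyc b * tprod bs.
Proof. by rewrite /tprod big_cons. Qed.

Lemma tcyc_mono b : uniq b -> mon (tcyc b) (cperm b).
Proof.
elim/seq_cons2_ind: b => [|x|x y b IH]; first by constructor.
  by rewrite tcyc1 cperm1; constructor.
rewrite tcyc_cons cperm_cons => /andP[]; rewrite in_cons negb_or => /andP[xy _] U.
by apply: mono_mul; [exact: (mono_t2 rels)|exact: IH].
Qed.

Lemma tprod_mono bs : uniq (flatten bs) -> mon (tprod bs) (cycprod bs).
Proof.
elim: bs => [|b bs IH]; first by rewrite /tprod /cycprod !big_nil; constructor.
rewrite /= cat_uniq tprod_cons cycprod_cons => /and3P[Ub _ U].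
by apply: mono_mul; [exact: tcyc_mono|exact: IH].
Qed.

Lemma tcyc_conj b x s : uniq b -> mon x s ->
  tcyc b * x = (-1) ^+ (odd_perm s && odd_perm (cperm b)) * (x * tcyc (map s b)).
Proof.
move=> + mx; elim/seq_cons2_ind: b => [|i|i j b IH].
- by rewrite odd_perm1 andbF /tcyc /= mulr1 !mul1r.
- by rewrite cperm1 odd_perm1 andbF /= !tcyc1 mulr1 !mul1r.
rewrite /= tcyc_cons => /andP[]; rewrite in_cons negb_or => /andP[ij _] U.
rewrite -mulrA IH // mulrA (commr_sign (t2 i j)) -mulrA (mulrA (t2 i j)) (t2_mono rels mx) //.
rewrite cperm_cons odd_permM odd_tperm ij andb_addr andbT signr_addb -!mulrA -tcyc_cons.
rewrite mulrA (commr_sign ((-1) ^+ _)) -!mulrA; by [].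
Qed.

Lemma tprod_conj bs x s : uniq (flatten bs) -> mon x s ->
  tprod bs * x = (-1) ^+ (odd_perm s && odd_perm (cycprod bs)) * (x * tprod (map (map s) bs)).
Proof.
move=> + mx; elim: bs => [|b bs IH].
  by rewrite /tprod /cycprod !big_nil odd_perm1 andbF mulr1 !mul1r.
rewrite /= cat_uniq => /and3P[Ub _ U].
rewrite !tprod_cons cycprod_cons odd_permM andb_addr signr_addb -mulrA IH //.
rewrite [LHS]mulrA (commr_sign (tcyc b)) -[LHS]mulrA [tcyc b * _]mulrA (tcyc_conj Ub mx) !mulrA.
by rewrite (commr_sign ((-1) ^+ (odd_perm s && odd_perm (cperm b)))).
Qed.

Lemma tprod_rem1 bs : tprod [seq b <- bs | size b != 1%N] = tprod bs.
Proof.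
elim: bs => //= b bs IH; rewrite tprod_cons -IH; case: ifP => [_|]; first by rewrite tprod_cons.
by case: b => [|x [|y b]] //= _; rewrite tcyc1 mul1r.
Qed.

Lemma odd_cycprod (bs : seq (seq 'I_n)) :
  uniq (flatten bs) -> all odd (shape bs) -> odd_perm (cycprod bs) = false.
Proof.
elim: bs => [|b bs IH]; first by rewrite /cycprod big_nil odd_perm1.
rewrite /= cat_uniq cycprod_cons odd_permM => /and3P[Ub _ U] /andP[ob os].
by rewrite IH // odd_cperm ?ob //; case: b ob {Ub}.
Qed.

Lemma tprod_conj_odd bs x s : uniq (flatten bs) -> all odd (shape bs) -> mon x s ->
  tprod bs * x = x * tprod (map (map s) bs).
Proof. by move=> U o mx; rewrite (tprod_conj U mx) odd_cycprod // andbF mul1r. Qed.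

(* An odd power of [tprod bs] is a sign, so [tprod bs] is not conjugate to its opposite. *)
Lemma tprod_cycprod_inj bs (h : 'S_n) : uniq (flatten bs) -> all odd (shape bs) ->
  cycprod (map (map h) bs) = cycprod bs -> tprod (map (map h) bs) = tprod bs.
Proof.
move=> U o cE; have Uh : uniq (flatten (map (map h) bs)).
  by rewrite -map_flatten map_inj_uniq //; apply: perm_inj.
have := tprod_mono Uh; rewrite cE => /mono_sign_uniq/(_ (tprod_mono U)) [[] E]; last first.
  by rewrite E mul1r.
(* [m] is odd and a multiple of every cycle length, so the [m]-th power of the permutation is 1 and
   that of the word is a sign. *)
pose m := (\prod_(k <- shape bs) k)%N.
have om : odd m.
  rewrite /m; elim: (shape bs) o => [|k s IH] /=; first by rewrite big_nil.
  by rewrite big_cons oddM => /andP[-> /IH].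
have gm : (cycprod bs ^+ m = 1)%g.
  apply: invg_inj; rewrite invg1 -expgVn; apply/permP => i; rewrite perm1.
  have [/flattenP[b bb ib]|ib] := boolP (i \in flatten bs); last first.
    rewrite permX iter_fix //; apply: (@perm_inj _ (cycprod bs)); by rewrite permKV cycprod_out.
  have [k ->] : exists k, m = (size b * k)%N.
    have /perm_to_rem p : size b \in shape bs by apply: map_f.
    by rewrite /m (perm_big _ p) big_cons; eexists.
  rewrite expgM permX iter_fix // permX -(order_cycprod U bb ib).
  by apply: iter_order; apply: perm_inj.
have mX x s k : mon x s -> mon (x ^+ k) (s ^+ k)%g.
  by move=> mx; elim: k => [|k IH]; rewrite ?expr0 ?expg0 ?exprS ?expgS;
    [constructor|exact: mono_mul].
have [e eE] : exists e : bool, tprod bs ^+ m = (-1) ^+ e.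
  by apply: mono1_sign; rewrite -gm; apply: mX; apply: tprod_mono.
have C : tprod (map (map h) bs) = colift h * tprod bs * lift h.
  by rewrite -mulrA (tprod_conj_odd U o (lift_mono h)) mulrA coliftK mul1r.
(* This power is a sign, hence central and unchanged by conjugation with [lift h]; opposite words
   would have opposite odd powers. *)
have : tprod (map (map h) bs) ^+ m = tprod bs ^+ m.
  rewrite (_ : tprod bs ^+ m = colift h * tprod bs ^+ m * lift h); last first.
    by rewrite eE commr_sign -mulrA coliftK mulr1.
  rewrite {}C {om gm eE}; elim: m => [|m IH]; first by rewrite !expr0 mulr1 coliftK.
  by rewrite exprS IH !exprS -!mulrA (mulrA (lift h)) liftK mul1r.
rewrite E expr1 mulN1r exprNn -signr_odd om expr1 mulN1r eE => /esym/algT_opp_neq/eqP.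
by rewrite signr_eq0.
Qed.

Lemma C_alphaE alpha : C_alpha tau alpha =
  let parts := [seq k <- alpha | k != 1%N] in
  \sum_(t : (sumn parts).-tuple 'I_n | uniq t) tprod (reshape parts t).
Proof.
rewrite /C_alpha /=; apply: eq_bigr => t _.
by rewrite -map_reshape /tprod big_map.
Qed.

Section Reshape.
Variable sh : seq nat.
Hypothesis osh : all odd sh.
Implicit Types t u : (sumn sh).-tuple 'I_n.

Lemma flatten_reshape_tuple t : flatten (reshape sh t) = t.
Proof. by rewrite reshapeKr // size_tuple. Qed.

Lemma shape_reshape_tuple t : shape (reshape sh t) = sh.
Proof. by rewrite reshapeKl // size_tuple. Qed.

Lemma tprod_reshape_mono t : uniq t -> mon (tprod (reshape sh t)) (cycprod (reshape sh t)).
Proof. by move=> Ut; apply: tprod_mono; rewrite flatten_reshape_tuple. Qed.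

Lemma tprod_reshape_conj t x s : uniq t -> mon x s ->
  tprod (reshape sh t) * x = x * tprod (reshape sh (map_tuple s t)).
Proof.
move=> Ut mx; rewrite (tprod_conj_odd _ _ mx) ?flatten_reshape_tuple ?shape_reshape_tuple //.
by rewrite map_reshape.
Qed.

(** Families of the same shape differ by a relabelling, so [tprod_cycprod_inj] applies. This
    excludes cancellation between the summands of [C_alpha] over one permutation. *)
Lemma tprod_reshape_inj t u : uniq t -> uniq u ->
  cycprod (reshape sh t) = cycprod (reshape sh u) -> tprod (reshape sh t) = tprod (reshape sh u).
Proof.
move=> Ut Uu; have [|h <-] := perm_uniq_trans _ Uu Ut.
  by rewrite !size_tuple.
rewrite -map_reshape; apply: tprod_cycprod_inj; first by rewrite flatten_reshape_tuple.
by rewrite shape_reshape_tuple.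
Qed.

End Reshape.

Lemma all_odd_parts alpha : all odd alpha -> all odd [seq k <- alpha | k != 1%N].
Proof. by move/allP=> o; apply/allP => k; rewrite mem_filter => /andP[_ /o]. Qed.

(** Moving a word over [s] past a summand relabels the indices by [s], without sign as odd cycles
    are even permutations; this only permutes the summands. *)
Lemma C_alpha_mono_comm alpha x s : all odd alpha -> mon x s ->
  C_alpha tau alpha * x = x * C_alpha tau alpha.
Proof.
move=> o mx; rewrite C_alphaE /= mulr_suml mulr_sumr.
rewrite [RHS](reindex_inj (h := map_tuple s)) /=; last first.
  by move=> t u /(congr1 val) /= /(inj_map perm_inj) /val_inj.
apply: eq_big => [t|t Ut]; first by rewrite map_inj_uniq //; apply: perm_inj.
exact/tprod_reshape_conj/mx/Ut/all_odd_parts.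
Qed.

Lemma C_alpha_supercenter alpha : all odd alpha -> supercenter tau (C_alpha tau alpha).
Proof.
move=> o; exists [:: C_alpha tau alpha]; rewrite big_seq1; split=> // a.
(* [C_alpha] is even, so supercommuting means commuting, and words suffice by linearity. *)
rewrite inE => /eqP->; exists false; split; last first.
  move=> pb y [s [_ ->]]; rewrite mul1r mulr_sumr mulr_suml; apply: eq_bigr => p _.
  by rewrite -scalerAr -scalerAl (C_alpha_mono_comm o (mono_word_prod _)).
rewrite C_alphaE; apply: big_ind => [|x y|t Ut]; [exact: homog0|exact: homogD|].
have := mono_homog (tprod_reshape_mono Ut); rewrite odd_cycprod //.
  by rewrite flatten_reshape_tuple.
by rewrite shape_reshape_tuple all_odd_parts.
Qed.

(** The sign makes each summand the super-conjugate of an [x] of parity [pa]. The signs of the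
    chosen lifts do not matter, since each lift appears together with its inverse. *)
Definition avg (pa : bool) (x : A) : A :=
  \sum_(h : 'S_n) (-1) ^+ (pa && odd_perm h) * (colift h * x * lift h).

Lemma avg_sum pa (s : seq (R * seq 'I_n.-1)) :
  avg pa (\sum_(p <- s) p.1 *: \prod_(k <- p.2) tau k) =
  \sum_(p <- s) p.1 *: avg pa (\prod_(k <- p.2) tau k).
Proof.
rewrite /avg; under [RHS]eq_bigr => p _ do rewrite scaler_sumr.
rewrite exchange_big; apply: eq_bigr => h _ /=.
rewrite mulr_sumr mulr_suml mulr_sumr; apply: eq_bigr => p _.
by rewrite -scalerAr -scalerAl -scalerAr.
Qed.

(** Reindexing by [h |-> z * h] conjugates [w] by [y]; by the hypothesis the average becomes its own
    opposite. *)
Lemma avg_vanish pa w y z : mon y z ->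
  w * y = - ((-1) ^+ (pa && odd_perm z) * (y * w)) -> avg pa w = 0.
Proof.
move=> my wy; apply: algT_opp_neq; rewrite {1}/avg (reindex_inj (mulgI z)) /= -sumrN.
apply: eq_bigr => h _.
have [e zE] := mono_sign_uniq (lift_mono (z * h)%g) (mono_mul my (lift_mono h)).
have cE : colift (z * h)%g * y = (-1) ^+ e * colift h.
  have := coliftK (z * h)%g; rewrite zE => /(congr1 (fun x => (-1) ^+ e * x * colift h)).
  rewrite mulr1 !mulrA -(commr_sign (colift _)) -[_ * _ * (_ ^+ e)]mulrA -signr_addb addbb mulr1.
  by rewrite -!mulrA liftK mulr1.
rewrite odd_permM andb_addr signr_addb zE -!mulrA (mulrA w) [w * ((-1) ^+ e)]commr_sign.
rewrite -!mulrA (mulrA w y) wy mulNr !mulrN -!mulrA (mulrA (colift _) (_ ^+ e)).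
rewrite [colift _ * ((-1) ^+ e)]commr_sign -!mulrA (mulrA (colift _) (_ ^+ _)).
rewrite [colift _ * ((-1) ^+ _)]commr_sign.
rewrite -!mulrA (mulrA (colift _) y) cE -!mulrA; congr (- _).
rewrite (mulrA ((-1) ^+ (pa && odd_perm z)) ((-1) ^+ _)) (commr_sign ((-1) ^+ (pa && odd_perm z))).
rewrite -!mulrA; congr (_ * _).
set u := colift h * _.
rewrite [(-1) ^+ e * (_ * _)]mulrA (commr_sign ((-1) ^+ e)) -!mulrA.
by rewrite (mulrA (_ ^+ e)) -signr_addb addbb mul1r mulrA -signr_addb addbb mul1r.
Qed.

End SignedWords.

(** * The grading by the symmetric group *)

(** A separate name for the function space, to carry the convolution product. *)
Definition group_alg (R : pzRingType) (A : algType R) (G : finGroupType) : Type := {ffun G -> A}.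

Section GroupAlgebra.
Variables (R : pzRingType) (A : algType R) (G : finGroupType).
Local Notation AG := (group_alg A G).
Implicit Types x y z : AG.

HB.instance Definition _ := GRing.Lmodule.copy AG {ffun G -> A}.

Definition ga_mono (a : A) (g : G) : AG := [ffun h => if h == g then a else 0].
Definition ga_mul x y : AG := [ffun g => \sum_h x h * y (h^-1 * g)%g].

Lemma ga_mulA : associative ga_mul.
Proof.
move=> x y z; apply/ffunP => g; rewrite !ffunE.
under eq_bigr => h _ do rewrite ffunE mulr_sumr.
under [RHS]eq_bigr => h _ do rewrite ffunE mulr_suml.
rewrite [RHS]exchange_big; apply: eq_bigr => k _ /=.
rewrite [RHS](reindex_inj (mulgI k)); apply: eq_bigr => h _ /=.
by rewrite mulKg invMg mulgA mulrA.
Qed.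

Lemma ga_mono_mul a b g h : ga_mul (ga_mono a g) (ga_mono b h) = ga_mono (a * b) (g * h)%g.
Proof.
apply/ffunP => k; rewrite !ffunE (bigD1 g) //= big1 ?addr0 => [|l lg]; last first.
  by rewrite !ffunE (negPf lg) mul0r.
rewrite !ffunE eqxx -(inj_eq (mulgI g)) mulKVg.
by case: eqP; rewrite ?mulr0.
Qed.

Lemma ga_mul1 : left_id (ga_mono 1 1%g) ga_mul.
Proof.
move=> x; apply/ffunP => g; rewrite ffunE (bigD1 1%g) //= big1 ?addr0 => [|l l1]; last first.
  by rewrite !ffunE (negPf l1) mul0r.
by rewrite !ffunE eqxx mul1r invg1 mul1g.
Qed.

Lemma ga_mulr1 : right_id (ga_mono 1 1%g) ga_mul.
Proof.
move=> x; apply/ffunP => g; rewrite ffunE (bigD1 g) //= big1 ?addr0 => [|l lg]; last first.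
  by rewrite !ffunE -(inj_eq (mulgI l)) mulKVg mulg1 eq_sym (negPf lg) mulr0.
by rewrite !ffunE mulVg eqxx mulr1.
Qed.

Lemma ga_mulDl : left_distributive ga_mul +%R.
Proof.
move=> x y z; apply/ffunP => g; rewrite !ffunE -big_split; apply: eq_bigr => h _.
by rewrite !ffunE mulrDl.
Qed.

Lemma ga_mulDr : right_distributive ga_mul +%R.
Proof.
move=> x y z; apply/ffunP => g; rewrite !ffunE -big_split; apply: eq_bigr => h _.
by rewrite !ffunE mulrDr.
Qed.

Lemma ga_oner_neq0 : ga_mono 1 1%g != 0.
Proof. by apply/eqP => /ffunP/(_ 1%g)/eqP; rewrite !ffunE eqxx oner_eq0. Qed.

HB.instance Definition _ := GRing.Zmodule_isNzRing.Build AG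
  ga_mulA ga_mul1 ga_mulr1 ga_mulDl ga_mulDr ga_oner_neq0.

Lemma ga_scalerAl (c : R) x y : c *: (x * y) = (c *: x) * y.
Proof.
apply/ffunP => g; rewrite !ffunE scaler_sumr; apply: eq_bigr => h _.
by rewrite !ffunE scalerAl.
Qed.

HB.instance Definition _ := GRing.Lmodule_isLalgebra.Build R AG ga_scalerAl.

Lemma ga_scalerAr (c : R) x y : c *: (x * y) = x * (c *: y).
Proof.
apply/ffunP => g; rewrite !ffunE scaler_sumr; apply: eq_bigr => h _.
by rewrite !ffunE scalerAr.
Qed.

HB.instance Definition _ := GRing.Lalgebra_isAlgebra.Build R AG ga_scalerAr.

Lemma ga_monoM a b g h : ga_mono a g * ga_mono b h = ga_mono (a * b) (g * h)%g.
Proof. exact: ga_mono_mul. Qed.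

Lemma ga_monoX a g k : ga_mono a g ^+ k = ga_mono (a ^+ k) (g ^+ k)%g.
Proof. by elim: k => // k IH; rewrite !exprS expgS IH ga_monoM. Qed.

Lemma ga_monoN a g : - ga_mono a g = ga_mono (- a) g.
Proof. by apply/ffunP => h; rewrite !ffunE; case: ifP; rewrite ?oppr0. Qed.

End GroupAlgebra.

(** * The morphism from the algebra to its group algebra *)

Section Grading.
Variables (R : numClosedFieldType) (n : nat) (A : algType R) (tau : 'I_n.-1 -> A).
Hypothesis rels : An_rels tau.

(** The transpositions [adj k] satisfy the same relations with every right side equal to 1, so the
    signs come from [tau] alone. *)
Lemma ga_rels : An_rels (fun k => ga_mono (tau k) (adj k) : group_alg A 'S_n).
Proof.
case: rels => sq br far; split=> [k|k l kl|k l kl].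
- by rewrite ga_monoM sq /adj tperm2.
- rewrite ga_monoM ga_monoX br //; congr ga_mono.
  pose i := widen_ord (leq_pred n) k; pose j := Ordinal (adjacent_proof k).
  pose m := Ordinal (adjacent_proof l).
  have ij : i != j by rewrite -val_eqE /= neq_ltn ltnSn.
  have im : i != m by rewrite -val_eqE /= kl; lia.
  have jm : j != m by rewrite -val_eqE /= kl; lia.
  have -> : adj l = tperm j m by rewrite /adj; congr tperm; apply: val_inj.
  have -> : adj k = tperm i j by [].
  have E1 : (tperm i j * (tperm j m * tperm i j) = tperm i m)%g.
    by rewrite -{1}(tpermV i j) -conjgE tpermJ tpermR tpermD.
  have E2 : (tperm j m * (tperm i j * tperm j m) = tperm i m)%g.
    by rewrite -{1}(tpermV j m) -conjgE tpermJ tpermL tpermD // eq_sym.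
  by rewrite 2!expgS expg1 -!mulgA E2 !mulgA -(mulgA (tperm i j)) E1 tperm2.
- rewrite ga_monoM ga_monoX far //.
  have -> : -1 = ga_mono (-1) 1%g :> group_alg A 'S_n by rewrite -ga_monoN.
  congr ga_mono; have C : (adj k * adj l = adj l * adj k)%g.
    rewrite conjgC; congr (_ * _)%g; rewrite {1}/adj tpermJ /adj.
    by rewrite !tpermD // -val_eqE /=; lia.
  by rewrite expgS expg1 {1}C -mulgA (mulgA (adj k)) tperm2 mul1g tperm2.
Qed.

Hypothesis univ : An_universal tau.

Lemma grading_exists : exists f : {linear A -> group_alg A 'S_n},
  forall m x s, mono tau m x s -> f x = ga_mono x s.
Proof.
have [[f fE] _] := univ ga_rels.
suff fM : forall m x s, mono tau m x s -> f x = ga_mono x s by exists f.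
move=> m x s; elim=> [|{}x {}s k _ _ IH|{}x {}s _ IH].
- by rewrite rmorph1.
- by rewrite rmorphM /= fE IH ga_monoM.
- by rewrite raddfN /= IH ga_monoN.
Qed.

End Grading.

(** * The basis of the supercenter *)

Section CycleType.
Variable n : nat.

Lemma sumn_parts (s : seq nat) : sumn s = (sumn [seq k <- s | k != 1%N] + count_mem 1%N s)%N.
Proof. by elim: s => //= k s ->; case: eqP => [->|] /=; lia. Qed.

Lemma odd_partition_parts_inj (a b : seq nat) : odd_partition n a -> odd_partition n b ->
  perm_eq [seq k <- a | k != 1%N] [seq k <- b | k != 1%N] -> a = b.
Proof.
move=> /and3P[sa _ /eqP na] /and3P[sb _ /eqP nb] pE.
have c1 : count_mem 1%N a = count_mem 1%N b.
  (* The number of parts 1 is what the other parts leave of [n]. *)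
  have := sumn_parts a; have := sumn_parts b.
  by rewrite na nb (perm_sumn pE); lia.
apply: (sorted_eq (leT := geq)) sa sb _.
- by move=> x y z /= yx zy; apply: leq_trans zy yx.
- by move=> x y /andP[/= yx xy]; apply/eqP; rewrite eqn_leq yx xy.
apply/allP => k _ /=; have [->|k1] := eqVneq k 1%N; first by rewrite c1.
have := seq.permP pE (pred1 k); rewrite !count_filter.
by rewrite !(eq_count (a1 := predI _ _) (a2 := pred1 k)) => [/eqP|i|i] //=; case: eqP => //= ->.
Qed.

Lemma odd_partition_cycprod (a b : seq nat)
    (t : (sumn [seq k <- a | k != 1%N]).-tuple 'I_n)
    (u : (sumn [seq k <- b | k != 1%N]).-tuple 'I_n) :
  odd_partition n a -> odd_partition n b -> uniq t -> uniq u ->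
  cycprod (reshape [seq k <- a | k != 1%N] t) = cycprod (reshape [seq k <- b | k != 1%N] u) ->
  a = b.
Proof.
move=> pa pb Ut Uu tu; apply: odd_partition_parts_inj => //.
apply/allP => k; have [->|k1 _ /=] := eqVneq k 1%N.
  by rewrite mem_cat !mem_filter.
(* The points on cycles of length [k] number [k] times the multiplicity, which says nothing for
   [k = 0]; but 0 is not odd. *)
have [->|k0] := eqVneq k 0%N.
  have no0 (s : seq nat) : odd_partition n s -> 0%N \notin s.
    by case/and3P=> _ /allP os _; apply/negP => /os.
  by rewrite !(count_memPn _) // mem_filter negb_and no0.
have H c (v : (sumn [seq k <- c | k != 1%N]).-tuple 'I_n) : uniq v ->
    #|[set i | fingraph.order (cycprod (reshape [seq k <- c | k != 1%N] v))^-1%g i == k]| =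
    (k * count_mem k [seq k <- c | k != 1%N])%N.
  move=> Uv; rewrite cycprod_count ?flatten_reshape_tuple //.
  by rewrite -/(shape _) shape_reshape_tuple.
have := H a t Ut; rewrite tu (H b u Uu) => /eqP.
by rewrite eqn_pmul2l ?lt0n // eq_sym.
Qed.

End CycleType.

(** * Spanning and linear independence *)

Section Basis.
Variables (R : numClosedFieldType) (n : nat) (A : algType R) (tau : 'I_n.-1 -> A).
Hypothesis rels : An_rels tau.

Notation mon := (mono tau n).

(** Repeated partitions are allowed, so that sums are concatenations; [Cspan_coef] collects the
    coefficients. *)
Definition Cspan (x : A) := exists l : seq (R * seq nat),
  all (fun p => odd_partition n p.2) l /\ x = \sum_(p <- l) p.1 *: C_alpha tau p.2.

Lemma Cspan0 : Cspan 0.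
Proof. by exists [::]; rewrite big_nil. Qed.

Lemma CspanD x y : Cspan x -> Cspan y -> Cspan (x + y).
Proof.
by move=> [l [lo ->]] [m [mo ->]]; exists (l ++ m); rewrite all_cat lo mo big_cat.
Qed.

Lemma CspanZ c x : Cspan x -> Cspan (c *: x).
Proof.
move=> [l [lo ->]]; exists [seq (c * p.1, p.2) | p <- l]; rewrite all_map big_map scaler_sumr.
by split; [apply: sub_all lo|apply: eq_bigr => p _; rewrite scalerA].
Qed.

Lemma Cspan_C alpha : odd_partition n alpha -> Cspan (C_alpha tau alpha).
Proof. by move=> o; exists [:: (1, alpha)]; rewrite /= o big_seq1 scale1r. Qed.

(** The cycle [b] commutes with itself and supercommutes with the other, disjoint blocks. These have
    odd total parity, because [b] is odd and the whole product even. *)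
Lemma tprod_even_cycle bs b : uniq (flatten bs) -> b \in bs -> odd_perm (cperm b) ->
  odd_perm (cycprod bs) = false -> tprod tau bs * tcyc tau b = - (tcyc tau b * tprod tau bs).
Proof.
move=> U /path.splitPr bb; case: bb U => b1 b2; rewrite flatten_cat /= => U ob.
have [U1 U2 Ub] : [/\ uniq (flatten b1), uniq (flatten b2) & uniq b].
  by move: U; rewrite !cat_uniq => /and3P[-> _ /and3P[-> _ ->]].
have F cs : (forall i, i \in flatten cs -> i \notin b) -> map (map (cperm b)) cs = cs.
  move=> cb; apply: map_id_in => c ccs; apply: map_id_in => i ic.
  by rewrite cperm_out // cb //; apply/flattenP; exists c.
have F1 : map (map (cperm b)) b1 = b1.
  apply: F => i i1; apply: contraL U => ib; rewrite cat_uniq.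
  by rewrite [has _ _](_ : _ = true) ?andbF //; apply/hasP; exists i; rewrite // mem_cat ib.
have F2 : map (map (cperm b)) b2 = b2.
  apply: F => i i2; apply: contraL U => ib; rewrite cat_uniq [uniq (b ++ _)]cat_uniq.
  by rewrite [has (mem b) _](_ : _ = true) ?andbF //; apply/hasP; exists i.
have E cs : uniq (flatten cs) -> map (map (cperm b)) cs = cs ->
    tprod tau cs * tcyc tau b = (-1) ^+ odd_perm (cycprod cs) * (tcyc tau b * tprod tau cs).
  by move=> Uc Fc; rewrite (tprod_conj rels Uc (tcyc_mono rels Ub)) ob Fc.
rewrite /cycprod big_cat big_cons !odd_permM ob -/(cycprod _) -/(cycprod _) /= => o12.
have {o12} oE : odd_perm (cycprod b1) = ~~ odd_perm (cycprod b2).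
  by move: o12; case: odd_perm; case: odd_perm.
rewrite {1}/tprod big_cat big_cons -/(tprod _ _) -/(tprod _ _).
rewrite /tprod big_cat big_cons -/(tprod _ _) -/(tprod _ _) /=.
rewrite -!mulrA (E _ U2 F2) !mulrA (commr_sign (tprod tau b1 * tcyc tau b)).
have {}E := E _ U1 F1.
have -> : tcyc tau b * tprod tau b1 = (-1) ^+ odd_perm (cycprod b1) * (tprod tau b1 * tcyc tau b).
  by rewrite E mulrA -expr2 sqrr_sign mul1r.
by rewrite oE signrN !mulNr opprK !mulrA.
Qed.

Lemma avg_tprod bs : uniq (flatten bs) -> all odd (shape bs) ->
  exists N : nat, avg rels false (tprod tau bs) =
    (\sum_(u : (sumn (shape bs)).-tuple 'I_n | uniq u) tprod tau (reshape (shape bs) u)) *+ N.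
Proof.
move=> U o; have st : size (flatten bs) == sumn (shape bs) by rewrite size_flatten.
have [N E] := sum_perm_tuple (t := Tuple st) (fun u => tprod tau (reshape (shape bs) u)) U.
exists N; rewrite -E; apply: eq_bigr => h _.
rewrite mul1r -mulrA (tprod_conj_odd rels U o (lift_mono rels h)) mulrA coliftK mul1r.
by rewrite /= -map_reshape flattenK.
Qed.

Lemma Cspan_avg x g : mon x g -> Cspan (avg rels (odd_perm g) x).
Proof.
move=> mx; case og: (odd_perm g).
  (* An odd [x] commutes with itself, where supercommutation would require a sign. *)
  rewrite (avg_vanish rels mx) ?og ?mulN1r ?opprK //; exact: Cspan0.
have [bs [bE b0 sbs gE]] := cperm_decomp g.
have U : uniq (flatten bs) by rewrite (perm_uniq bE) enum_uniq.
have mb := tprod_mono rels U; rewrite -gE in mb.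
have [e ->] := mono_sign_uniq rels mx mb.
have -> : avg rels false ((-1) ^+ e * tprod tau bs) = ((-1) ^+ e) *: avg rels false (tprod tau bs).
  rewrite scaler_sign /avg; case: e; last by rewrite mul1r.
  by rewrite -sumrN; apply: eq_bigr => h _; rewrite !mul1r expr1 mulN1r mulrN mulNr.
apply: CspanZ; have [o|/allPn[k /mapP[b bb ->] ob]] := boolP (all odd (shape bs)); last first.
  have Ub : uniq b.
    elim: bs U bb {bE b0 sbs gE mb} => // c bs IH; rewrite /= cat_uniq => /and3P[Uc _ /IH{}IH].
    by rewrite in_cons => /predU1P[->|/IH].
  have bn : b != [::] by apply: contraNneq b0 => <-.
  have oc : odd_perm (cperm b) by rewrite odd_cperm.
  rewrite (avg_vanish rels (tcyc_mono rels Ub)); first exact: Cspan0.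
  by rewrite mul1r; apply: tprod_even_cycle; rewrite // -gE.
(* The lengths of [bs] form the partition, fixed points included; the singletons contribute 1 and
   are dropped as in [C_alpha]. *)
rewrite -tprod_rem1; set cs := filter _ bs.
have Uc : uniq (flatten cs).
  apply: subseq_uniq U; rewrite /cs; elim: (bs) => //= b bs' IH.
  by case: ifP => _ /=; [apply: cat_subseq|apply: subseq_trans IH (suffix_subseq _ _)].
have ocs : all odd (shape cs).
  apply/allP => k /mapP[c]; rewrite mem_filter => /andP[_ cb] ->.
  by apply: (allP o); apply: map_f.
have [N ->] := avg_tprod Uc ocs; rewrite -scaler_nat; apply: CspanZ.
have := Cspan_C (alpha := shape bs); rewrite C_alphaE /= filter_map; apply.
by rewrite /odd_partition sbs o -size_flatten (perm_size bE) -cardE card_ord eqxx.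
Qed.

Lemma homog_supercentral_Cspan x : homog_supercentral tau x -> Cspan x.
Proof.
case=> pa [[s [sp xE]] xc].
(* By supercentrality every summand equals [x], and [n!] is invertible in characteristic 0. *)
have avgE : avg rels pa x = x *+ n`!.
  rewrite -card_Sn -sumr_const; apply: eq_bigr => h _.
  rewrite -mulrA (xc _ _ (mono_homog (lift_mono rels h))) (mulrA (colift _ _)) commr_sign -mulrA.
  by rewrite (mulrA (colift _ _)) coliftK mul1r mulrA -expr2 sqrr_sign mul1r.
have xA : x = n`!%:R^-1 *: avg rels pa x.
  by rewrite avgE -scaler_nat scalerA mulVf ?scale1r // pnatr_eq0 -lt0n fact_gt0.
rewrite xA; apply: CspanZ; rewrite {1}xE avg_sum.
rewrite big_seq; apply: (big_ind Cspan Cspan0 CspanD) => p /sp <-; apply: CspanZ.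
by rewrite -odd_word; apply/Cspan_avg/mono_word_prod.
Qed.

Lemma supercenter_Cspan x : supercenter tau x -> Cspan x.
Proof.
case=> s [sc ->]; rewrite big_seq; apply: (big_ind Cspan Cspan0 CspanD) => a /sc.
exact: homog_supercentral_Cspan.
Qed.

Lemma Cspan_coef x : Cspan x -> exists (s : seq (seq nat)) (c : seq nat -> R),
  all (odd_partition n) s /\ x = \sum_(alpha <- s) c alpha *: C_alpha tau alpha.
Proof.
case=> l [lo ->]; exists (undup (map snd l)), (fun a => \sum_(p <- l | p.2 == a) p.1); split.
  by apply/allP => a; rewrite mem_undup => /mapP[p /(allP lo) + ->].
under [RHS]eq_bigr => a _ do rewrite scaler_suml big_mkcond.
rewrite exchange_big /= big_seq [RHS]big_seq; apply: eq_bigr => p pl.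
rewrite (bigD1_seq p.2) ?undup_uniq ?mem_undup ?map_f //= eqxx big1 ?addr0 // => a ap.
by rewrite eq_sym (negPf ap).
Qed.

Hypothesis univ : An_universal tau.

Lemma C_alpha_free (s : seq (seq nat)) (c : seq nat -> R) :
  uniq s -> all (odd_partition n) s -> \sum_(alpha <- s) c alpha *: C_alpha tau alpha = 0 ->
  forall alpha, alpha \in s -> c alpha = 0.
Proof.
move=> Us so s0 a as_; have [f fE] := grading_exists rels univ.
have pa := allP so a as_; have /and3P[_ oa /eqP na] := pa.
(* There is room in ['I_n] for a family of distinct indices; [g0] is then a permutation of cycle
   type [a], and the relation is read at its component. *)
have sz : (sumn [seq k <- a | k != 1%N] <= n)%N by rewrite -na [leqRHS]sumn_parts leq_addr.
have st : size (take (sumn [seq k <- a | k != 1%N]) (enum 'I_n)) == sumn [seq k <- a | k != 1%N].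
  by rewrite size_takel // -cardE card_ord.
pose t0 := Tuple st; have U0 : uniq t0 by rewrite take_uniq // enum_uniq.
pose g0 := cycprod (reshape [seq k <- a | k != 1%N] t0).
have fC b : f (C_alpha tau b) g0 =
    \sum_(t : (sumn [seq k <- b | k != 1%N]).-tuple 'I_n | uniq t &&
      (cycprod (reshape [seq k <- b | k != 1%N] t) == g0))
        tprod tau (reshape [seq k <- b | k != 1%N] t).
  rewrite C_alphaE /= linear_sum /= sum_ffunE big_mkcondr; apply: eq_bigr => t Ut.
  by rewrite (fE _ _ _ (tprod_reshape_mono rels Ut)) ffunE eq_sym.
have fCb b : b \in s -> b != a -> f (C_alpha tau b) g0 = 0.
  move=> bs ba; rewrite fC big1 // => t /andP[Ut /eqP tg].
  by case/eqP: ba; apply: (odd_partition_cycprod (allP so b bs) pa Ut U0 tg).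
(* The summands over [g0] are all equal to the one at [t0]; the form [N.+1] records that there is at
   least one. *)
have [N fCa] : exists N : nat,
    f (C_alpha tau a) g0 = tprod tau (reshape [seq k <- a | k != 1%N] t0) *+ N.+1.
  rewrite fC (bigD1 t0) ?U0 ?eqxx //=.
  rewrite (eq_bigr (fun=> tprod tau (reshape [seq k <- a | k != 1%N] t0))); last first.
    move=> t /andP[/andP[Ut /eqP tg] _].
    by apply: (tprod_reshape_inj rels) => //; apply: all_odd_parts.
  by rewrite sumr_const -mulrS; eexists.
have : f (\sum_(alpha <- s) c alpha *: C_alpha tau alpha) g0 = 0 by rewrite s0 linear0 ffunE.
rewrite linear_sum /= sum_ffunE (bigD1_seq a) //= big_seq_cond big1 => [
  |b /andP[bs ba]]; last first.
  by rewrite linearZ ffunE fCb // scaler0.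
rewrite addr0 linearZ ffunE fCa -scaler_nat scalerA => /eqP.
rewrite scaler_eq0 mulf_eq0 pnatr_eq0 orbF => /orP[/eqP //|/eqP t00].
(* A word cannot vanish, since its product with the reversed word is 1. *)
have [w [e [tE _]]] := monoP (tprod_reshape_mono rels U0).
have := word_rev rels w; have -> : \prod_(k <- w) tau k = 0.
  by apply/eqP; move: tE; rewrite t00 mulr_sign => /esym/eqP; case: e; rewrite ?oppr_eq0.
by rewrite mul0r => /eqP; rewrite eq_sym oner_eq0.
Qed.

End Basis.

Theorem mainTheorem15 (R : numClosedFieldType) (n : nat)
    (A : algType R) (tau : 'I_n.-1 -> A) :
  An_rels tau -> An_universal tau ->
  [/\ (forall alpha, odd_partition n alpha -> supercenter tau (C_alpha tau alpha)),
      (forall (s : seq (seq nat)) (c : seq nat -> R),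
          uniq s -> all (odd_partition n) s ->
          \sum_(alpha <- s) c alpha *: C_alpha tau alpha = 0 ->
          forall alpha, alpha \in s -> c alpha = 0) &
      (forall x, supercenter tau x ->
          exists (s : seq (seq nat)) (c : seq nat -> R),
            all (odd_partition n) s /\
            x = \sum_(alpha <- s) c alpha *: C_alpha tau alpha)].
Proof.
move=> rels univ; split=> [alpha /and3P[_ o _]|s c|x /(supercenter_Cspan rels)].
- exact: C_alpha_supercenter.
- exact: C_alpha_free.
- exact: Cspan_coef.
Qed.
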